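(* Let $F:\mathcal{C}\to\mathcal{D}$ be a functor. Then: (i) $F$ is separable if and only if $F$ is semiseparable and faithful; (ii) $F$ is naturally full if and only if $F$ is semiseparable and full.
   Context: For a functor $F:\mathcal{C}\to\mathcal{D}$ let $\mathcal{F}^F:\mathrm{Hom}_{\mathcal{C}}(-,-)\to\mathrm{Hom}_{\mathcal{D}}(F-,F-)$ be the natural transformation (of functors $\mathcal{C}^{\mathrm{op}}\times\mathcal{C}\to\mathsf{Set}$) with $\mathcal{F}^F_{X,Y}(f)=F(f)$. $F$ is separable if there is a natural transformation $\mathcal{P}^F:\mathrm{Hom}_{\mathcal{D}}(F-,F-)\to\mathrm{Hom}_{\mathcal{C}}(-,-)$ with $\mathcal{P}^F\circ\mathcal{F}^F=\mathrm{Id}$; naturally full if there is such a natural transformation $\mathcal{P}^F$ with $\mathcal{F}^F\circ\mathcal{P}^F=\mathrm{Id}$; semiseparable if there is such a natural transformation $\mathcal{P}^F$ with $\mathcal{F}^F\circ\mathcal{P}^F\circ\mathcal{F}^F=\mathcal{F}^F$. *)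

(* Defs.v *)
From Stdlib Require Import FunctionalExtensionality.

Set Implicit Arguments.
Unset Strict Implicit.

(* Composition is written in the usual order: [comp g f] is "g after f". *)
Record Category : Type := {
  Obj : Type;
  Hom : Obj -> Obj -> Type;
  id : forall X : Obj, Hom X X;
  comp : forall X Y Z : Obj, Hom Y Z -> Hom X Y -> Hom X Z;
  comp_id_l : forall (X Y : Obj) (f : Hom X Y), comp (id Y) f = f;
  comp_id_r : forall (X Y : Obj) (f : Hom X Y), comp f (id X) = f;
  comp_assoc : forall (W X Y Z : Obj)
      (h : Hom Y Z) (g : Hom X Y) (f : Hom W X),
      comp h (comp g f) = comp (comp h g) f
}.

Arguments Obj C : rename.
Arguments Hom {C} X Y : rename.
Arguments id {C} X : rename.
Arguments comp {C X Y Z} g f : rename.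

Declare Scope category_scope.
Delimit Scope category_scope with cat.
Open Scope category_scope.

Notation "g ∘ f" := (comp g f) (at level 40, left associativity)
  : category_scope.

Record Functor (C D : Category) : Type := {
  fobj : Obj C -> Obj D;
  fmap : forall X Y : Obj C, Hom X Y -> Hom (fobj X) (fobj Y);
  fmap_id : forall X : Obj C, fmap (id X) = id (fobj X);
  fmap_comp : forall (X Y Z : Obj C) (g : Hom Y Z) (f : Hom X Y),
      fmap (g ∘ f) = fmap g ∘ fmap f
}.

Arguments fobj {C D} F X : rename.
Arguments fmap {C D} F {X Y} f : rename.

Record NatTrans (C D : Category) (F G : Functor C D) : Type := {
  component : forall X : Obj C, Hom (fobj F X) (fobj G X);
  naturality : forall (X Y : Obj C) (f : Hom X Y),
      component Y ∘ fmap F f = fmap G f ∘ component X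
}.

Arguments component {C D F G} eta X : rename.

Definition nt_id (C D : Category) (F : Functor C D) : NatTrans F F.
Proof.
  refine {| component := fun X => id (fobj F X) |}.
  abstract (intros; now rewrite comp_id_l, comp_id_r).
Defined.

Definition nt_comp (C D : Category) (F G H : Functor C D)
    (beta : NatTrans G H) (alpha : NatTrans F G) : NatTrans F H.
Proof.
  refine {| component := fun X => component beta X ∘ component alpha X |}.
  abstract (intros; now rewrite <- comp_assoc, naturality, comp_assoc,
            naturality, comp_assoc).
Defined.

Definition opposite (C : Category) : Category.
Proof.
  refine {| Obj := Obj C;
            Hom := fun X Y => @Hom C Y X;
            id := fun X => @id C X;
            comp := fun X Y Z g f => @comp C Z Y X f g |}.
  - abstract (intros; apply comp_id_r).
  - abstract (intros; apply comp_id_l).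
  - abstract (intros; symmetry; apply comp_assoc).
Defined.

Definition product (C D : Category) : Category.
Proof.
  refine {| Obj := (Obj C * Obj D)%type;
            Hom := fun X Y => (@Hom C (fst X) (fst Y) *
                               @Hom D (snd X) (snd Y))%type;
            id := fun X => (id (fst X), id (snd X));
            comp := fun X Y Z g f => (fst g ∘ fst f, snd g ∘ snd f) |}.
  - abstract (intros X Y [f f']; cbn; now rewrite !comp_id_l).
  - abstract (intros X Y [f f']; cbn; now rewrite !comp_id_r).
  - abstract (intros; cbn; now rewrite !comp_assoc).
Defined.

(* Types and functions with Leibniz equality play the role of the category
   of sets. *)
Definition SET : Category.
Proof.
  refine {| Obj := Type;
            Hom := fun A B => A -> B;
            id := fun A a => a;
            comp := fun A B C g f a => g (f a) |};
  abstract reflexivity.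
Defined.

Definition functor_comp (C D E : Category)
    (G : Functor D E) (F : Functor C D) : Functor C E.
Proof.
  refine {| fobj := fun X => fobj G (fobj F X);
            fmap := fun X Y f => fmap G (fmap F f) |}.
  - abstract (intros; now rewrite !fmap_id).
  - abstract (intros; now rewrite !fmap_comp).
Defined.

Definition functor_op (C D : Category) (F : Functor C D) :
  Functor (opposite C) (opposite D).
Proof.
  refine (@Build_Functor (opposite C) (opposite D) (fobj F)
            (fun X Y f => @fmap C D F Y X f) _ _).
  - abstract exact (fun X => @fmap_id C D F X).
  - abstract exact (fun X Y Z g f => @fmap_comp C D F Z Y X f g).
Defined.

Definition functor_product (C C' D D' : Category)
    (F : Functor C D) (G : Functor C' D') :
  Functor (product C C') (product D D').
Proof.
  refine (@Build_Functor (product C C') (product D D')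
            (fun X => (fobj F (fst X), fobj G (snd X)))
            (fun X Y f => (fmap F (fst f), fmap G (snd f))) _ _).
  - abstract (intros; cbn; now rewrite !fmap_id).
  - abstract (intros; cbn; now rewrite !fmap_comp).
Defined.

(* A morphism (X, Y) -> (X', Y') of C^op x C is a pair of morphisms
   u : X' -> X and v : Y -> Y' of C, and acts by f |-> v f u. *)
Definition hom_functor (C : Category) : Functor (product (opposite C) C) SET.
Proof.
  refine (@Build_Functor (product (opposite C) C) SET
            (fun X => @Hom C (fst X) (snd X))
            (fun X Y uv f => @comp C _ _ _ (@comp C _ _ _ (snd uv) f) (fst uv))
            _ _).
  - abstract (intros; cbn; apply functional_extensionality; intro f;
              now rewrite comp_id_r, comp_id_l).
  - abstract (intros; cbn; apply functional_extensionality; intro h;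
              now rewrite !comp_assoc).
Defined.

(* Hom_D(F-, F-) *)
Definition hom_functor_along (C D : Category) (F : Functor C D) :
  Functor (product (opposite C) C) SET :=
  functor_comp (hom_functor D) (functor_product (functor_op F) F).

Definition functor_nt (C D : Category) (F : Functor C D) :
  NatTrans (hom_functor C) (hom_functor_along F).
Proof.
  refine (@Build_NatTrans _ _ (hom_functor C) (hom_functor_along F)
            (fun X f => @fmap C D F (fst X) (snd X) f) _).
  abstract (intros; cbn; apply functional_extensionality; intro h;
            now rewrite !fmap_comp).
Defined.

Definition separable (C D : Category) (F : Functor C D) : Prop :=
  exists P : NatTrans (hom_functor_along F) (hom_functor C),
    nt_comp P (functor_nt F) = nt_id (hom_functor C).

Definition naturally_full (C D : Category) (F : Functor C D) : Prop :=
  exists P : NatTrans (hom_functor_along F) (hom_functor C),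
    nt_comp (functor_nt F) P = nt_id (hom_functor_along F).

Definition semiseparable (C D : Category) (F : Functor C D) : Prop :=
  exists P : NatTrans (hom_functor_along F) (hom_functor C),
    nt_comp (nt_comp (functor_nt F) P) (functor_nt F) = functor_nt F.

Definition faithful (C D : Category) (F : Functor C D) : Prop :=
  forall (X Y : Obj C) (f g : Hom X Y), fmap F f = fmap F g -> f = g.

Definition full (C D : Category) (F : Functor C D) : Prop :=
  forall (X Y : Obj C) (g : Hom (fobj F X) (fobj F Y)),
    exists f : Hom X Y, fmap F f = g.

(* Main.v *)
Require Import Defs.
From Stdlib Require Import FunctionalExtensionality ProofIrrelevance Setoid.

(** Tested on morphisms, the three conditions on [P] read P(F f) = f, F(P g) = g and F(P(F f)) = F
    f; this is the content of the [_witness_iff] lemmas. Either one-sided inverse law implies the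
    third equation, a left inverse making F injective on hom-sets and a right inverse making it
    surjective. Conversely, injectivity cancels the outer F, and surjectivity writes each g as F f.
    The same [P] serves in every direction. *)

Lemma nt_ext {C D : Category} {F G : Functor C D} (a b : NatTrans F G) :
  (forall X, component a X = component b X) -> a = b.
Proof.
  destruct a as [a na], b as [b nb]; cbn; intro H.
  apply functional_extensionality_dep in H; subst b.
  (* Once the components are identified, the two naturality proofs inhabit the same proposition. *)
  f_equal; apply proof_irrelevance.
Qed.

Lemma nt_SET_eq_iff {C : Category} {F G : Functor C SET} (a b : NatTrans F G) :
  a = b <-> forall X x, component a X x = component b X x.
Proof.
  split.
  - now intros ->.
  - intro H; apply nt_ext; intro X.
    exact (functional_extensionality _ _ (H X)).
Qed.

Section HomTransformations.

Context {C D : Category} {F : Functor C D}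
  (P : NatTrans (hom_functor_along F) (hom_functor C)).

(** The ascribed type holds by conversion and hides the pair objects of the product category. *)
Definition hom_component (X Y : Obj C) :
  Hom (fobj F X) (fobj F Y) -> Hom X Y := component P (X, Y).

(** At a literal pair [(X, Y)] both composites compute, so only the pair has to be destructed. *)
Lemma separable_witness_iff :
  nt_comp P (functor_nt F) = nt_id (hom_functor C) <->
  forall (X Y : Obj C) (f : Hom X Y), hom_component X Y (fmap F f) = f.
Proof.
  rewrite nt_SET_eq_iff; split.
  - exact (fun H X Y => H (X, Y)).
  - intros H [X Y]; exact (H X Y).
Qed.

Lemma naturally_full_witness_iff :
  nt_comp (functor_nt F) P = nt_id (hom_functor_along F) <->
  forall (X Y : Obj C) (g : Hom (fobj F X) (fobj F Y)),
    fmap F (hom_component X Y g) = g.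
Proof.
  rewrite nt_SET_eq_iff; split.
  - exact (fun H X Y => H (X, Y)).
  - intros H [X Y]; exact (H X Y).
Qed.

Lemma semiseparable_witness_iff :
  nt_comp (nt_comp (functor_nt F) P) (functor_nt F) = functor_nt F <->
  forall (X Y : Obj C) (f : Hom X Y),
    fmap F (hom_component X Y (fmap F f)) = fmap F f.
Proof.
  rewrite nt_SET_eq_iff; split.
  - exact (fun H X Y => H (X, Y)).
  - intros H [X Y]; exact (H X Y).
Qed.

End HomTransformations.

Theorem proposition1p3 (C D : Category) (F : Functor C D) :
  (separable F <-> semiseparable F /\ faithful F) /\
  (naturally_full F <-> semiseparable F /\ full F).
Proof.
  split; split.
  - intros [P HP]; rewrite separable_witness_iff in HP; split.
    + exists P; apply semiseparable_witness_iff; intros; now rewrite HP.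
    + intros X Y f g Hfg; now rewrite <- (HP X Y f), Hfg, HP.
  - intros [[P HP] Hfaithful]; rewrite semiseparable_witness_iff in HP.
    (* Applying F to P(F f) = f turns it into [HP]. *)
    exists P; apply separable_witness_iff; intros; now apply Hfaithful.
  - intros [P HP]; rewrite naturally_full_witness_iff in HP; split.
    + exists P; apply semiseparable_witness_iff; intros; apply HP.
    + intros X Y g; exists (hom_component P X Y g); apply HP.
  - intros [[P HP] Hfull]; rewrite semiseparable_witness_iff in HP.
    exists P; apply naturally_full_witness_iff; intros X Y g.
    destruct (Hfull X Y g) as [f <-]; apply HP.
Qed.
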